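(* Let $$\mathcal U:=\left\{x\mapsto\varphi\left(\left(I_{d+1}-e^{xM}\right)e_0\right)\ :\ M\in\mathbb R^{(d+1)\times(d+1)},\ \varphi\in(\mathbb R^{d+1})^*,\ d\in\mathbb N\right\}.$$ A kernel $k$ for some RKHS is fully consistent if and only if the map $k_y:x\mapsto k(y,x)$ is such that $k_y\in\mathcal U$ for all $y\in\mathbb R_+$.
   Context: $I_{d+1}$ is the identity matrix of dimension $d+1$, $e_0=(1,0,\dots,0)^\top\in\mathbb R^{d+1}$ is the first unit basis vector, and $(\mathbb R^{d+1})^*$ is the dual space of $\mathbb R^{d+1}$. The elements of $\mathcal U$ are functions of $x\in\mathbb R_+$. A reproducing kernel Hilbert space (RKHS) is a Hilbert space of functions with bounded point evaluations. A kernel function on $\mathbb R_+$ is a symmetric function $k:\mathbb R_+\times\mathbb R_+\to\mathbb R$ such that for all $n\in\mathbb N$ and distinct $x_1,\dots,x_n\in\mathbb R_+$ the matrix $(k(x_i,x_j))_{i,j=1}^n$ is positive semidefinite; kernel functions are exactly the reproducing kernels of RKHSs. A kernel function $k$ on $\mathbb R_+$ is called fully consistent if for any choice $y_1,\dots,y_N\in\mathbb R_+$, $N\in\mathbb N$, there is a finite-dimensional space $V\subseteq C^1(\mathbb R_+,\mathbb R)$ such that (1) $\partial_x(V)\subseteq V$ and (2) $k_{y_1},\dots,k_{y_N}\in V$.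
   Formalization: The formal theorem adds the hypothesis k(y,0)=0 for all y; without it the claim fails, since every function in U vanishes at x=0 while the constant kernel k=1 is fully consistent but not in U. *)

(* Defs.v *)
From HB Require Import structures.
From mathcomp Require Import all_boot all_order all_algebra interval_inference.
From mathcomp Require Import all_classical all_reals all_analysis.
Set Implicit Arguments.
Unset Strict Implicit.
Unset Printing Implicit Defensive.
Import Order.TTheory GRing.Theory Num.Theory.
Import numFieldNormedType.Exports.
Local Open Scope classical_set_scope.
Local Open Scope ring_scope.

(* {nonneg R} is the half-line R_+ = [0, +oo[ as a type, so that equality of
   functions below is equality on R_+, and x%:num is the underlying real. *)

Definition zero_Rplus (R : realType) : {nonneg R} := NngNum (lexx 0).

Definition linear_subspace (R : realType) (T : Type) (V : set (T -> R)) : Prop :=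
  V 0 /\ forall (a : R) (f g : T -> R), V f -> V g -> V (a *: f + g).

Definition finite_dimensional (R : realType) (T : Type) (V : set (T -> R)) : Prop :=
  exists (n : nat) (b : 'I_n -> T -> R),
    (forall i, V (b i)) /\
    forall f, V f -> exists c : 'I_n -> R, f = \sum_(i < n) c i *: b i.

(* Extends f to R by the constant f 0 on the negative half-line; only its
   values on R_+ are used below. *)
Definition ext (R : realType) (f : {nonneg R} -> R) : R -> R :=
  fun t => f (insubd (zero_Rplus R) t).

Definition diff_quotient (R : realType) (f : {nonneg R} -> R) (x : {nonneg R})
    (h : R) : R := h^-1 * (ext f (x%:num + h) - ext f x%:num).

(* Increments h != 0 that stay in R_+, tending to 0: differentiation is
   one-sided at the endpoint 0 and two-sided elsewhere. *)
Definition increments (R : realType) (x : {nonneg R}) : set_system R :=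
  within [set h | 0 <= x%:num + h] 0^'.

Definition derivable_Rplus (R : realType) (f : {nonneg R} -> R) : Prop :=
  forall x, cvg (diff_quotient f x @ increments x).

Definition deriv_Rplus (R : realType) (f : {nonneg R} -> R) : {nonneg R} -> R :=
  fun x => lim (diff_quotient f x @ increments x).

Definition C1_Rplus (R : realType) : set ({nonneg R} -> R) :=
  [set f | derivable_Rplus f /\
           {within [set x : R | 0 <= x], continuous (ext (deriv_Rplus f))}].

Definition kernel_function (R : realType)
    (k : {nonneg R} -> {nonneg R} -> R) : Prop :=
  (forall x y, k x y = k y x) /\
  forall (n : nat) (x : 'I_n -> {nonneg R}), injective x ->
    forall c : 'cV[R]_n,
      0 <= (c^T *m (\matrix_(i < n, j < n) k (x i) (x j)) *m c) 0 0.

Definition dot_norm (R : realType) (T : Type)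
    (dot : (T -> R) -> (T -> R) -> R) (f : T -> R) : R := Num.sqrt (dot f f).

(* A Hilbert space of functions on T with bounded point evaluations; the values
   of rkhs_dot outside rkhs_set are irrelevant. *)
Record rkhs (R : realType) (T : Type) := Rkhs {
  rkhs_set : set (T -> R);
  rkhs_dot : (T -> R) -> (T -> R) -> R;
  rkhs_subspace : linear_subspace rkhs_set;
  rkhs_dotC : forall f g, rkhs_set f -> rkhs_set g ->
    rkhs_dot f g = rkhs_dot g f;
  rkhs_dot_linear : forall (a : R) f g h,
    rkhs_set f -> rkhs_set g -> rkhs_set h ->
    rkhs_dot (a *: f + g) h = a * rkhs_dot f h + rkhs_dot g h;
  rkhs_dot_ge0 : forall f, rkhs_set f -> 0 <= rkhs_dot f f;
  rkhs_dot_definite : forall f, rkhs_set f -> rkhs_dot f f = 0 -> f = 0;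
  rkhs_complete : forall u : nat -> T -> R, (forall n, rkhs_set (u n)) ->
    (forall e : R, 0 < e -> exists N : nat, forall m n : nat,
       (N <= m)%N -> (N <= n)%N -> dot_norm rkhs_dot (u m - u n) < e) ->
    exists2 f, rkhs_set f &
      (fun n => dot_norm rkhs_dot (u n - f)) @ \oo --> (0 : R);
  rkhs_eval_bounded : forall x : T, exists C : R, forall f, rkhs_set f ->
    `|f x| <= C * dot_norm rkhs_dot f }.

Definition reproducing_kernel (R : realType) (T : Type) (H : rkhs R T)
    (k : T -> T -> R) : Prop :=
  forall y, rkhs_set H (k y) /\ forall f, rkhs_set H f -> f y = rkhs_dot H f (k y).

Definition rkhs_kernel (R : realType) (T : Type) (k : T -> T -> R) : Prop :=
  exists H : rkhs R T, reproducing_kernel H k.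

Definition fully_consistent (R : realType)
    (k : {nonneg R} -> {nonneg R} -> R) : Prop :=
  kernel_function k /\
  forall (N : nat) (y : 'I_N -> {nonneg R}),
    exists V : set ({nonneg R} -> R),
      [/\ linear_subspace V /\ finite_dimensional V,
          V `<=` @C1_Rplus R,
          @deriv_Rplus R @` V `<=` V &
          forall i, V (k (y i))].

Definition expmx (R : realType) (n : nat) (A : 'M[R]_n.+1) : 'M[R]_n.+1 :=
  limn (series (fun j : nat => (j`!%:R : R)^-1 *: A ^+ j)).

Definition e0 (R : realType) (d : nat) : 'cV[R]_d.+1 := delta_mx 0 0.

Definition U_set (R : realType) : set ({nonneg R} -> R) :=
  [set f | exists (d : nat) (M : 'M[R]_d.+1) (phi : {scalar 'cV[R]_d.+1}),
     f = fun x => phi ((1%:M - expmx (x%:num *: M)) *m e0 R d)].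

Lemma extE (R : realType) (f : {nonneg R} -> R) (x : {nonneg R}) :
  ext f x%:num = f x.
Proof. by rewrite /ext valKd. Qed.

Lemma expmx0 (R : realType) (n : nat) : expmx (0 : 'M[R]_n.+1) = 1.
Proof.
rewrite /expmx; apply: cvg_lim => //; rewrite -(cvg_shiftS _).
apply: (@cvg_trans _ ((fun=> (1 : 'M[R]_n.+1)) @ \oo)); last exact: cvg_cst.
apply: near_eq_cvg; apply: nearW => j.
rewrite /series /= big_nat_recl // expr0 fact0 invr1 scale1r big1 ?addr0 //.
by move=> i _; rewrite expr0n scaler0.
Qed.

Lemma U_set_at0 (R : realType) (f : {nonneg R} -> R) : U_set f -> f (zero_Rplus R) = 0.
Proof.
case=> d [M [phi ->]] /=.
by rewrite scale0r expmx0 -[1%:M]/(1 : 'M[R]_d.+1) subrr mul0mx linear0.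
Qed.

(* Every function in U_set vanishes at 0, whereas the constant kernel 1 is the
   kernel of an RKHS and is fully consistent. Membership of the k y in U_set
   therefore characterizes full consistency only among kernels with k y 0 = 0,
   that is, for RKHSs of functions that vanish at 0. *)

Section ConstantKernel.
Variable R : realType.

Let T : Type := {nonneg R}.
Let consts : set (T -> R) := [set f | forall x, f x = f (zero_Rplus R)].
Let dot (f g : T -> R) : R := f (zero_Rplus R) * g (zero_Rplus R).

Let dot_normE (f : T -> R) : dot_norm dot f = `|f (zero_Rplus R)|.
Proof. by rewrite /dot_norm /dot -expr2 sqrtr_sqr. Qed.

Let consts_subspace : linear_subspace consts.
Proof.
split=> [x //|a f g hf hg x].
by rewrite /= !fctE hf hg.
Qed.

Let consts_complete (u : nat -> T -> R) : (forall n, consts (u n)) ->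
    (forall e : R, 0 < e -> exists N : nat, forall m n : nat,
       (N <= m)%N -> (N <= n)%N -> dot_norm dot (u m - u n) < e) ->
    exists2 f, consts f & (fun n => dot_norm dot (u n - f)) @ \oo --> (0 : R).
Proof.
move=> _ uC; pose v : nat -> R := fun n => u n (zero_Rplus R).
have cv : cvgn v.
  apply/cauchy_cvgP/cauchy_exP => e e0.
  have [N hN] := uC e e0; exists (v N).
  exists N => // n /= Nn; rewrite /ball /= /v.
  by have := hN N n (leqnn _) Nn; rewrite dot_normE.
exists (fun=> limn v) => //.
have -> : (fun n => dot_norm dot (u n - fun=> limn v)) = (fun n => `|v n - limn v|).
  by apply/funext => n; rewrite dot_normE.
rewrite -(normr0 R) -(subrr (limn v)); apply: cvg_norm.
by apply: cvgB => //; exact: cvg_cst.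
Qed.

Let const_rkhs : rkhs R T.
Proof.
apply: (@Rkhs R T consts dot) => //.
- by move=> f g _ _; rewrite /dot mulrC.
- by move=> a f g h _ _ _; rewrite /dot /= !fctE mulrDl mulrA.
- by move=> f _; rewrite /dot -expr2 sqr_ge0.
- move=> f cf /eqP; rewrite /dot mulf_eq0 orbb => /eqP f0.
  by apply/funext => x; rewrite cf f0.
- by move=> x; exists 1 => f cf; rewrite mul1r dot_normE cf.
Defined.

Lemma rkhs_kernel_cst1 : rkhs_kernel (fun _ _ : {nonneg R} => 1 : R).
Proof. by exists const_rkhs => y; split=> //= f cf; rewrite /dot mulr1 cf. Qed.

Let deriv_consts (f : T -> R) (x : T) :
  consts f -> diff_quotient f x @ increments x --> (0 : R).
Proof.
move=> cf.
have -> : diff_quotient f x = fun=> 0.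
  apply/funext => h; rewrite /diff_quotient /ext.
  by rewrite [f (insubd _ _)]cf [X in _ - X]cf subrr mulr0.
exact: cvg_cst.
Qed.


Let increments_proper (x : T) : ProperFilter (increments x).
Proof.
apply: Build_ProperFilter_ex => A [e /= e0 hA].
exists (e / 2); apply: hA => /=.
- by rewrite sub0r normrN gtr0_norm ?divr_gt0// ltr_pdivrMr// ltr_pMr// ltr1n.
- by rewrite gt_eqF// divr_gt0.
- by rewrite addr_ge0// divr_ge0// ltW.
Qed.

Let deriv_Rplus_consts (f : T -> R) : consts f -> deriv_Rplus f = 0.
Proof.
move=> cf; apply/funext => x.
have pf := increments_proper x.
by apply: cvg_lim => //; exact: deriv_consts.
Qed.

Lemma fully_consistent_cst1 :
  fully_consistent (fun _ _ : {nonneg R} => 1 : R).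
Proof.
split; first split=> // n x _ c.
  have -> : \matrix_(i < n, j < n) 1 = (const_mx 1 : 'cV[R]_n) *m (const_mx 1 : 'rV[R]_n).
    apply/matrixP => i j; rewrite !mxE big_ord1 !mxE mulr1 //.
  rewrite mulmxA -mulmxA.
  have -> : (const_mx 1 : 'rV[R]_n) *m c = (c^T *m (const_mx 1 : 'cV[R]_n))^T.
    by rewrite trmx_mul trmxK trmx_const.
  by rewrite mxE big_ord1 [X in _ * X]mxE -expr2 sqr_ge0.
move=> N y; exists consts; split=> //.
- split=> //; exists 1%N, (fun=> fun=> 1); split=> // f cf.
  exists (fun=> f (zero_Rplus R)); rewrite big_ord1; apply/funext => x.
  by rewrite cf !fctE [RHS]mulr1.
- move=> f cf; split=> [x|].
    by apply/cvg_ex; exists 0; exact: deriv_consts.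
  rewrite deriv_Rplus_consts//; apply: continuous_subspaceT => t.
  exact: cvg_cst.
- by move=> _ [f cf <-]; rewrite deriv_Rplus_consts.
Qed.

Lemma cst1_notin_U_set : ~ U_set (fun _ : {nonneg R} => 1 : R).
Proof. by move=> /U_set_at0 /eqP; rewrite oner_eq0. Qed.

End ConstantKernel.

(* Main.v *)
(* If [b' = A b] on the half-line for a vector [b] of generators of a
   derivative-stable space, then the augmented vector [w = (1, b - b(0))] solves
   [w' = M w] with [M = [[0, 0], [A b(0), A]]] and [w(0) = e_0], hence
   [w(x) = e^{xM} e_0], because [e^{-xM} w(x)] has derivative 0; so each [c . b]
   that vanishes at 0 is [phi ((I - e^{xM}) e_0)] with [phi = (0, - c)], and no
   change of basis is needed.
   Conversely, the functions [x |-> r e^{xM} v], for fixed [M] and [v], form a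
   finite-dimensional space on which differentiation acts by [r |-> r M]; a
   function of [U] lies in the sum of two of them ([M = 0] gives the constant). *)
Require Import Defs.
From HB Require Import structures.
From mathcomp Require Import all_boot all_order all_algebra interval_inference.
From mathcomp Require Import all_classical all_reals all_analysis.
From mathcomp Require Import ring.
Set Implicit Arguments.
Unset Strict Implicit.
Unset Printing Implicit Defensive.
Import Order.TTheory GRing.Theory Num.Theory.
Import numFieldNormedType.Exports.
Local Open Scope classical_set_scope.
Local Open Scope ring_scope.

(** * Entrywise convergence and differentiation of the matrix exponential *)

Lemma cvg_mx_entrywise (R : realType) (m n : nat) (u : nat -> 'M[R]_(m, n))
    (A : 'M[R]_(m, n)) :
  (forall i j, (fun l => u l i j) @ \oo --> A i j) -> u @ \oo --> A.
Proof.
move=> uA P [Q AQ QP].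
have Qu : \forall l \near \oo, forall i j, Q i j (u l i j).
  apply: filter_forall => i; apply: filter_forall => j.
  by have := uA i j _ (AQ i j).
by move: Qu; apply: filterS => l; exact: QP.
Qed.

(* Coefficients of the [s]-th derivative of the [(i, k)] entry of [x |-> e^{xM}]. *)
Definition expmx_coef (R : realType) (n : nat) (M : 'M[R]_n.+1) (i k : 'I_n.+1)
  (s j : nat) : R := (M ^+ (j + s)) i k / j`!%:R.

(** The sum of all [|M p q|] dominates every absolute row sum of [M], so each further factor [M]
    multiplies the bound on the entries by at most this sum. *)
Lemma normr_exprmx_le (R : realType) (n : nat) (M : 'M[R]_n.+1) (j : nat) i k :
  `|(M ^+ j) i k| <= (\sum_p \sum_q `|M p q|) ^+ j.
Proof.
elim: j i k => [|j IH] i k; first by rewrite !expr0 mxE normr_nat lern1 leq_b1.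
rewrite exprS mxE (le_trans (ler_norm_sum _ _ _))// exprS.
apply: (@le_trans _ _ ((\sum_q `|M i q|) * (\sum_p \sum_q `|M p q|) ^+ j)).
  by rewrite mulr_suml ler_sum// => q _; rewrite normrM ler_wpM2l.
rewrite ler_wpM2r ?exprn_ge0 ?sumr_ge0// => [p _|]; first by rewrite sumr_ge0.
by rewrite [leRHS](bigD1 i)//= lerDl sumr_ge0// => p _; rewrite sumr_ge0.
Qed.

Lemma is_cvg_expmx_coef (R : realType) (n : nat) (M : 'M[R]_n.+1) i k s (x : R) :
  cvgn (pseries (expmx_coef M i k s) x).
Proof.
set K := \sum_p \sum_q `|M p q|.
have K0 : 0 <= K by rewrite sumr_ge0// => p _; rewrite sumr_ge0.
apply: normed_cvg.
(* Comparison with the exponential series: the [j]-th term is at most [K ^+ s] times the [j]-th term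
   of the series of [exp (K * |x|)]. *)
apply: (@series_le_cvg _ _ (K ^+ s *: exp_coeff (K * `|x|))).
- by move=> j; rewrite normr_ge0.
- by move=> j; rewrite mulr_ge0 ?exprn_ge0// exp_coeff_ge0// mulr_ge0.
- move=> j; rewrite /expmx_coef /exp_coeff /= !fctE /= !normrM normfV normr_nat normrX.
  rewrite [leRHS](_ : _ = K ^+ (j + s) / j`!%:R * `|x| ^+ j).
    by rewrite !ler_wpM2r ?invr_ge0 ?exprn_ge0 ?ler0n// normr_exprmx_le.
  by rewrite exprMn exprD /GRing.scale /=; ring.
- exact/is_cvg_seriesZ/is_cvg_series_exp_coeff.
Qed.

(** The factor [j + 1] produced by termwise differentiation turns [1 / (j + 1)!] into [1 / j!], and
    only the exponent of [M] stays shifted. *)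
Lemma pseries_diffs_expmx_coef (R : realType) (n : nat) (M : 'M[R]_n.+1) i k s :
  pseries_diffs (expmx_coef M i k s) = expmx_coef M i k s.+1.
Proof.
apply/funext => j; rewrite /pseries_diffs /expmx_coef addSnnS factS natrM invfM.
by rewrite mulrCA mulVKf// pnatr_eq0.
Qed.

Lemma expmx_entry (R : realType) (n : nat) (M : 'M[R]_n.+1) (x : R) i k :
  expmx (x *: M) i k = limn (pseries (expmx_coef M i k 0) x).
Proof.
rewrite /expmx; set A := \matrix_(i, k) limn (pseries (expmx_coef M i k 0) x).
suff EA : series (fun j => (j`!%:R)^-1 *: (x *: M) ^+ j) @ \oo --> A.
  by rewrite (cvg_lim _ EA) ?mxE.
apply: cvg_mx_entrywise => {}i {}k; rewrite mxE.
rewrite (_ : (fun l => _) = pseries (expmx_coef M i k 0) x).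
  exact: is_cvg_expmx_coef.
apply/funext => l; rewrite /pseries /series /= summxE; apply: eq_bigr => j _.
by rewrite exprZn /expmx_coef addn0 !mxE mulrCA mulrC [j`!%:R^-1 * _]mulrC.
Qed.

Lemma is_derive_expmx_coef (R : realType) (n : nat) (M : 'M[R]_n.+1) (x : R) i k :
  is_derive x 1 (fun t : R => expmx (t *: M) i k)
    (limn (pseries (expmx_coef M i k 1) x)).
Proof.
rewrite (_ : (fun t => _) = fun t => limn (pseries (expmx_coef M i k 0) t)).
  rewrite -pseries_diffs_expmx_coef.
  (* Termwise differentiation at [x] asks for convergence of the series and of its first two formal
     derivatives at some point farther from 0; [|x| + 1] is such a point. *)
  apply: (@pseries_snd_diffs _ _ (`|x| + 1)); rewrite ?pseries_diffs_expmx_coef;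
    try exact: is_cvg_expmx_coef.
  by rewrite [ltRHS]ger0_norm ?addr_ge0// ltrDl.
by apply/funext => t; rewrite expmx_entry.
Qed.

Lemma is_derive_expmx (R : realType) (n : nat) (M : 'M[R]_n.+1) (x : R) i k :
  is_derive x 1 (fun t : R => expmx (t *: M) i k) ((M *m expmx (x *: M)) i k).
Proof.
suff -> : (M *m expmx (x *: M)) i k = limn (pseries (expmx_coef M i k 1) x).
  exact: is_derive_expmx_coef.
apply/esym/cvg_lim => //; rewrite mxE.
rewrite (_ : pseries _ _ = fun l => \sum_j M i j * pseries (expmx_coef M j k 0) x l).
  under eq_bigr do rewrite expmx_entry.
  apply: cvg_big => [|j _]; first exact: add_continuous.
  by apply: cvgM; [exact: cvg_cst|exact: is_cvg_expmx_coef].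
apply/funext => l; rewrite /pseries /series /=.
under [RHS]eq_bigr do rewrite mulr_sumr.
rewrite exchange_big /=; apply: eq_bigr => j _.
rewrite /expmx_coef addn1 exprS mxE !mulr_suml; apply: eq_bigr => p _.
by rewrite addn0 !mulrA.
Qed.

(** Here [M ^+ j.+1] is split as [M ^+ j * M]. With [M] on the right, the derivative of [e^{-xM}]
    cancels against [w' = M w] in the product [e^{-xM} w(x)]. *)
Lemma is_derive_expmxr (R : realType) (n : nat) (M : 'M[R]_n.+1) (x : R) i k :
  is_derive x 1 (fun t : R => expmx (t *: M) i k) ((expmx (x *: M) *m M) i k).
Proof.
suff -> : (expmx (x *: M) *m M) i k = limn (pseries (expmx_coef M i k 1) x).
  exact: is_derive_expmx_coef.
apply/esym/cvg_lim => //; rewrite mxE.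
rewrite (_ : pseries _ _ = fun l => \sum_j pseries (expmx_coef M i j 0) x l * M j k).
  under eq_bigr do rewrite expmx_entry.
  apply: cvg_big => [|j _]; first exact: add_continuous.
  by apply: cvgM; [exact: is_cvg_expmx_coef|exact: cvg_cst].
apply/funext => l; rewrite /pseries /series /=.
under [RHS]eq_bigr do rewrite mulr_suml.
rewrite exchange_big /=; apply: eq_bigr => j _.
rewrite /expmx_coef addn1 exprSr mxE !mulr_suml; apply: eq_bigr => p _.
by rewrite addn0 -!mulrA; congr (_ * _); rewrite mulrC mulrA.
Qed.

(** * Derivatives on the half-line and derivatives on the real line *)

Lemma is_derive1_cvgP (R : realType) (F : R -> R) (x l : R) :
  is_derive x 1 F l <-> (fun h => h^-1 * (F (x + h) - F x)) @ 0^' --> l.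
Proof.
have -> : (fun h => h^-1 * (F (x + h) - F x)) =
          (fun h => h^-1 *: (F (h *: 1 + x) - F x)).
  by apply/funext => h; rewrite [h *: 1]mulr1 (addrC h).
split=> [[dF <-]|Fl]; first exact: dF.
by split; [apply/cvg_ex; exists l|exact: cvg_lim].
Qed.

Lemma is_derive1_continuous (R : realType) (F : R -> R) (x l : R) :
  is_derive x 1 F l -> {for x, continuous F}.
Proof. by case=> dF _; apply/differentiable_continuous/derivable1_diffP. Qed.

Lemma ext_restrict (R : realType) (F : R -> R) (t : R) :
  0 <= t -> ext (fun y : {nonneg R} => F y%:num) t = F t.
Proof. by move=> t0; exact: (extE _ (NngNum t0)). Qed.

(** Small positive increments are admissible at every point, the endpoint 0 included. Properness
    makes limits along [increments x] unique, so that [deriv_Rplus] can be computed. *)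
Lemma increments_proper_filter (R : realType) (x : {nonneg R}) :
  ProperFilter (increments x).
Proof.
apply: Build_ProperFilter_ex => A [e /= e0 hA].
exists (e / 2); apply: hA => /=.
- by rewrite sub0r normrN gtr0_norm ?divr_gt0// ltr_pdivrMr// ltr_pMr// ltr1n.
- by rewrite gt_eqF// divr_gt0.
- by rewrite addr_ge0// divr_ge0// ltW.
Qed.
#[local] Existing Instance increments_proper_filter.

Lemma deriv_Rplus_eq (R : realType) (f : {nonneg R} -> R) x (l : R) :
  diff_quotient f x @ increments x --> l -> deriv_Rplus f x = l.
Proof. by move=> fl; apply: cvg_lim. Qed.

Lemma diff_quotient_lin (R : realType) (a : R) (f g : {nonneg R} -> R) x (l m : R) :
  diff_quotient f x @ increments x --> l ->
  diff_quotient g x @ increments x --> m ->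
  diff_quotient (a *: f + g) x @ increments x --> a * l + m.
Proof.
move=> fl gm.
have -> : diff_quotient (a *: f + g) x =
          (fun h => a * diff_quotient f x h + diff_quotient g x h).
  apply/funext => h; rewrite /diff_quotient /ext /= !fctE /GRing.scale /=.
  by rewrite mulrCA -mulrDr; congr (_ * _); rewrite opprD addrACA -mulrBr.
by apply: cvgD gm; apply: cvgM fl; exact: cvg_cst.
Qed.

Lemma diff_quotient_restrict (R : realType) (F : R -> R) (x : {nonneg R}) (l : R) :
  is_derive x%:num 1 F l ->
  diff_quotient (fun y : {nonneg R} => F y%:num) x @ increments x --> l.
Proof.
move=> /is_derive1_cvgP Fl.
apply: (@cvg_trans _ ((fun h => h^-1 * (F (x%:num + h) - F x%:num)) @ increments x)).
  apply: near_eq_cvg; rewrite /increments near_withinE; apply: nearW => h /= xh.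
  by rewrite /diff_quotient !ext_restrict.
exact: cvg_within_filter Fl.
Qed.

(** At an interior point every increment of size at most [x] stays in the half-line, so near 0 the
    restriction in [increments] is void. *)
Lemma is_derive_ext (R : realType) (f : {nonneg R} -> R) (x : {nonneg R}) (l : R) :
  0 < x%:num -> diff_quotient f x @ increments x --> l ->
  is_derive x%:num 1 (ext f) l.
Proof.
move=> x0 fl; apply/is_derive1_cvgP; apply: cvg_trans fl => P /= [e e0 eP].
have [d d0 dx] : exists2 d, 0 < d & d <= Num.min e x%:num.
  by exists (Num.min e x%:num); rewrite // lt_min e0.
exists d => // h hd h0; apply: eP => //=.
  by rewrite (lt_le_trans hd)// (le_trans dx)// ge_min lexx.
move: hd; rewrite /= sub0r normrN => /ltW; rewrite ler_norml => /andP[hd _].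
rewrite addrC -lerBlDr sub0r (le_trans _ hd)// lerN2 (le_trans dx)//.
by rewrite ge_min lexx orbT.
Qed.

(** Differentiability at the endpoint gives right-continuity there, through [f(h) = f(0) + h q(h)]
    with [q] the difference quotient. *)
Lemma ext_cvg_at_right0 (R : realType) (f : {nonneg R} -> R) (l : R) :
  diff_quotient f (zero_Rplus R) @ increments (zero_Rplus R) --> l ->
  ext f @ 0^'+ --> f (zero_Rplus R).
Proof.
set o := zero_Rplus R => fl.
have fr : diff_quotient f o @ 0^'+ --> l.
  apply: cvg_trans fl => P /= [e e0 eP]; exists e => // h he h0.
  by apply: eP => //=; rewrite ?gt_eqF// add0r ltW.
rewrite -[f o]addr0 -[X in f o + X](mul0r l).
apply: (@cvg_trans _ ((fun h => f o + h * diff_quotient f o h) @ 0^'+)).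
  apply: near_eq_cvg; near=> h.
  have h0 : h != 0 by rewrite gt_eqF//; near: h; exact: nbhs_right_gt.
  by rewrite /diff_quotient mulVKf// add0r -[f o]extE subrKC.
apply: cvgD; first exact: cvg_cst.
apply: cvgM fr.
by apply: cvg_at_right_filter; exact: cvg_id.
Unshelve. all: by end_near. Qed.

(** * Scalar functions built from the matrix exponential *)

Definition expmx_form (R : realType) (n : nat) (M : 'M[R]_n.+1) (r : 'rV[R]_n.+1)
  (v : 'cV[R]_n.+1) (t : R) : R := (r *m (expmx (t *: M) *m v)) 0 0.

Lemma is_derive_expmx_form (R : realType) (n : nat) (M : 'M[R]_n.+1) r v (x : R) :
  is_derive x 1 (expmx_form M r v) (expmx_form M (r *m M) v x).
Proof.
have -> : expmx_form M r v =
    \sum_i \sum_j (r 0 i * v j 0) \*: (fun t => expmx (t *: M) i j).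
  apply/funext => t; rewrite /expmx_form mxE fct_sumE; apply: eq_bigr => i _.
  rewrite fct_sumE mxE mulr_sumr; apply: eq_bigr => j _.
  by rewrite /= [RHS]mulrAC mulrA.
apply: is_derive_eq.
  apply: is_derive_sum => i; apply: is_derive_sum => j; apply: is_deriveZ.
  exact: is_derive_expmx.
rewrite /expmx_form -mulmxA (mulmxA M) [RHS]mxE.
apply: eq_bigr => i _; rewrite [in RHS]mxE mulr_sumr; apply: eq_bigr => j _.
by rewrite [LHS]mulrAC mulrA.
Qed.

Lemma diff_quotient_expmx_form (R : realType) (n : nat) (M : 'M[R]_n.+1) r v
    (x : {nonneg R}) :
  diff_quotient (fun y : {nonneg R} => expmx_form M r v y%:num) x @ increments x -->
    expmx_form M (r *m M) v x%:num.
Proof. by apply: diff_quotient_restrict; exact: is_derive_expmx_form. Qed.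

(** * Linear differential equations on the half-line *)

(** Mean value theorem on [[0, x]]. At 0 only right-continuity is assumed, since [ext f] is constant
    on the negative side and may have a kink at 0. *)
Lemma diff_quotient0_cst (R : realType) (G : R -> R) (x : R) :
  0 <= x -> (forall t : R, 0 < t -> is_derive t 1 G 0) -> G @ 0^'+ --> G 0 ->
  G x = G 0.
Proof.
rewrite le_eqVlt => /orP[/eqP<- //|x0] G' G0.
have dG t : t \in `]0, x[ -> is_derive t 1 G 0.
  by rewrite in_itv /= => /andP[t0 _]; exact: G'.
have cG : {within `[0, x], continuous G}.
  apply/continuous_within_itvP => //; split => //.
    by move=> t /dG; exact: is_derive1_continuous.
  by apply: cvg_at_left_filter; exact/is_derive1_continuous/G'.
have [c _ /eqP] := MVT_segment (ltW x0) dG cG.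
by rewrite mul0r subr_eq0 => /eqP.
Qed.

Section LinearODE.
Variables (R : realType) (n : nat) (M : 'M[R]_n.+1).

Definition solves_ode (w : {nonneg R} -> 'cV[R]_n.+1) : Prop :=
  forall i x, diff_quotient (fun y => w y i 0) x @ increments x --> (M *m w x) i 0.

Lemma expmxN_mul_solution w x : solves_ode w ->
  expmx (x%:num *: (- M)) *m w x = w (zero_Rplus R).
Proof.
move=> ode; apply/matrixP => i k; rewrite (ord1 k) {k}.
(* The [i]-th entry of [e^{-tM} w(t)], extended to the real line so that the calculus of [is_derive]
   applies. *)
pose G t := \sum_j expmx (t *: - M) i j * ext (fun y => w y j 0) t.
have GE y : G y%:num = (expmx (y%:num *: - M) *m w y) i 0.
  by rewrite mxE; apply: eq_bigr => j _; rewrite extE.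
have G0 : G 0 = w (zero_Rplus R) i 0.
  by rewrite (GE (zero_Rplus R)) /= scale0r expmx0 mul1mx.
rewrite -G0 -GE; apply: diff_quotient0_cst => //.
  move=> t t0; pose y := NngNum (ltW t0).
  rewrite (_ : G = \sum_j (fun s => expmx (s *: - M) i j) *
                              ext (fun y => w y j 0)); last first.
    by apply/funext => s; rewrite fct_sumE.
  apply: is_derive_eq.
    apply: is_derive_sum => j; apply: is_deriveM.
      exact: is_derive_expmxr.
    exact: (@is_derive_ext _ _ y).
  under eq_bigr do rewrite (extE _ y).
  (* Product rule: the first summand comes from [w' = M w], the second from the derivative of
     [e^{-tM}]; they cancel. *)
  transitivity ((expmx (t *: - M) *m (M *m w y) +
                 (expmx (t *: - M) *m - M) *m w y) i 0).
    rewrite [RHS]mxE [X in _ = X + _]mxE [X in _ = _ + X]mxE -big_split /=.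
    by apply: eq_bigr => j _; congr (_ + _); exact: mulrC.
  by rewrite mulmxN mulNmx mulmxA subrr mxE.
(* Right-continuity of [G] at 0: its value there is written as a sum again, so that the limit is
   taken summand by summand. *)
rewrite [X in _ --> X](_ : _ =
    \sum_j expmx (0 *: - M) i j * w (zero_Rplus R) j 0); last first.
  by rewrite G0 scale0r expmx0 -[in LHS](mul1mx (w _)) mxE.
apply: cvg_big => [|j _]; first exact: add_continuous.
apply: cvgM; last exact: ext_cvg_at_right0 (ode j _).
by apply: cvg_at_right_filter; exact/is_derive1_continuous/is_derive_expmx.
Qed.

Lemma expmx_form_delta i v t :
  expmx_form M (delta_mx 0 i) v t = (expmx (t *: M) *m v) i 0.
Proof. by rewrite /expmx_form -rowE mxE. Qed.

Lemma expmx_solves_ode v : solves_ode (fun x => expmx (x%:num *: M) *m v).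
Proof.
move=> i x.
have -> : (fun y : {nonneg R} => (expmx (y%:num *: M) *m v) i 0) =
          (fun y => expmx_form M (delta_mx 0 i) v y%:num).
  by apply/funext => y; rewrite expmx_form_delta.
have -> : (M *m (expmx (x%:num *: M) *m v)) i 0 =
          expmx_form M (delta_mx 0 i *m M) v x%:num.
  by rewrite /expmx_form -mulmxA -rowE [RHS]mxE.
exact: diff_quotient_expmx_form.
Qed.

Lemma expmx_mulNmx (x : {nonneg R}) :
  expmx (x%:num *: M) *m expmx (x%:num *: - M) = 1%:M.
Proof.
apply: mulmx1C; apply/matrixP => i j.
have := expmxN_mul_solution x (@expmx_solves_ode (delta_mx j 0)).
rewrite /= scale0r expmx0 mul1mx mulmxA -colE => /matrixP/(_ i 0).
by rewrite !mxE andbT.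
Qed.

Lemma solution_expmx w x : solves_ode w ->
  w x = expmx (x%:num *: M) *m w (zero_Rplus R).
Proof.
by move=> ode; rewrite -(expmxN_mul_solution x ode) mulmxA expmx_mulNmx mul1mx.
Qed.

End LinearODE.

Definition consistent_space (R : realType) (V : set ({nonneg R} -> R)) : Prop :=
  [/\ linear_subspace V /\ finite_dimensional V, V `<=` @C1_Rplus R &
      @deriv_Rplus R @` V `<=` V].

Lemma C1_diff_quotient (R : realType) (f : {nonneg R} -> R) x :
  C1_Rplus f -> diff_quotient f x @ increments x --> deriv_Rplus f x.
Proof. by case=> df _; exact: df. Qed.

Definition expmx_form_space (R : realType) (n : nat) (M : 'M[R]_n.+1) v :
    set ({nonneg R} -> R) :=
  [set f | exists r, f = fun y => expmx_form M r v y%:num].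

Lemma expmx_form_space_consistent (R : realType) (n : nat) (M : 'M[R]_n.+1) v :
  consistent_space (expmx_form_space M v).
Proof.
have drE r : deriv_Rplus (fun y => expmx_form M r v y%:num) =
             fun y => expmx_form M (r *m M) v y%:num.
  by apply/funext => x; apply: deriv_Rplus_eq; exact: diff_quotient_expmx_form.
split.
- split.
    split.
      by exists 0; apply/funext => x; rewrite /expmx_form mul0mx mxE.
    move=> a _ _ [r ->] [s ->]; exists (a *: r + s); apply/funext => x.
    by rewrite /expmx_form mulmxDl -scalemxAl [RHS]mxE [X in _ = X + _]mxE.
  exists n.+1, (fun i y => expmx_form M (delta_mx 0 i) v y%:num); split.
    by move=> i; exists (delta_mx 0 i).
  move=> _ [r ->]; exists (r 0); apply/funext => x.
  rewrite fct_sumE /expmx_form mxE; apply: eq_bigr => i _.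
  by rewrite !fctE -rowE [in RHS]mxE.
- move=> _ [r ->]; split=> [x|].
    by apply/cvg_ex; eexists; exact: diff_quotient_expmx_form.
  rewrite drE; apply: (@subspace_eq_continuous _ _ _ (expmx_form M (r *m M) v)).
    by move=> t /set_mem t0; exact/esym/(ext_restrict (expmx_form M (r *m M) v) t0).
  apply: continuous_subspaceT => t.
  exact/is_derive1_continuous/is_derive_expmx_form.
- by move=> _ [_ [r ->] <-]; exists (r *m M).
Qed.

Lemma consistent_space_add (R : realType) (V W : set ({nonneg R} -> R)) :
  consistent_space V -> consistent_space W ->
  consistent_space [set f | exists2 g, V g & exists2 h, W h & f = g + h].
Proof.
move=> [[[V0 Vlin] [m [b [bV spanb]]]] VC1 dV] [[[W0 Wlin] [n [c [cW spanc]]]] WC1 dW].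
have dq g h x : V g -> W h ->
    diff_quotient (g + h) x @ increments x --> deriv_Rplus g x + deriv_Rplus h x.
  move=> /VC1 Cg /WC1 Ch.
  have := diff_quotient_lin (a := 1) (@C1_diff_quotient _ g x Cg)
                                     (@C1_diff_quotient _ h x Ch).
  by rewrite scale1r mul1r; exact.
have dD g h : V g -> W h -> deriv_Rplus (g + h) = deriv_Rplus g + deriv_Rplus h.
  by move=> Vg Wh; apply/funext => x; apply: deriv_Rplus_eq; exact: dq.
split.
- split.
    split; first by exists 0 => //; exists 0 => //; rewrite addr0.
    move=> a _ _ [g1 Vg1 [h1 Wh1 ->]] [g2 Vg2 [h2 Wh2 ->]].
    exists (a *: g1 + g2); first exact: Vlin.
    by exists (a *: h1 + h2); [exact: Wlin|rewrite scalerDr addrACA].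
  exists (m + n)%N,
    (fun i => match fintype.split i with inl p => b p | inr q => c q end).
  split=> [i|_ [g Vg [h Wh ->]]].
    case: fintype.split => [p|q].
      by exists (b p) => //; exists 0 => //; rewrite addr0.
    by exists 0 => //; exists (c q) => //; rewrite add0r.
  have [u ->] := spanb _ Vg; have [w ->] := spanc _ Wh.
  exists (fun i => match fintype.split i with inl p => u p | inr q => w q end).
  rewrite big_split_ord /=; congr (_ + _); apply: eq_bigr => i _.
    by rewrite (unsplitK (inl i)).
  by rewrite (unsplitK (inr i)).
- move=> _ [g Vg [h Wh ->]]; have [dg cg] := VC1 _ Vg; have [dh ch] := WC1 _ Wh.
  split=> [x|].
    by apply/cvg_ex; eexists; exact: dq Vg Wh.
  by rewrite dD//; exact: within_continuousD cg ch.
- move=> _ [_ [g Vg [h Wh ->]] <-]; exists (deriv_Rplus g).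
    by apply: dV; exists g.
  by exists (deriv_Rplus h); [apply: dW; exists h|exact: dD].
Qed.

Lemma rkhs_set_sum (R : realType) (T : Type) (H : rkhs R T) (I : finType)
    (c : I -> R) (f : I -> T -> R) :
  (forall i, rkhs_set H (f i)) -> rkhs_set H (\sum_i c i *: f i).
Proof.
have [H0 Hlin] := rkhs_subspace H.
by move=> Hf; elim/big_rec: _ => // i g _ Hg; exact: Hlin.
Qed.

Lemma rkhs_dot_suml (R : realType) (T : Type) (H : rkhs R T) (I : finType)
    (c : I -> R) (f : I -> T -> R) (g : T -> R) :
  (forall i, rkhs_set H (f i)) -> rkhs_set H g ->
  rkhs_dot H (\sum_i c i *: f i) g = \sum_i c i * rkhs_dot H (f i) g.
Proof.
have [H0 Hlin] := rkhs_subspace H.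
move=> Hf Hg.
suff [] : rkhs_set H (\sum_i c i *: f i) /\
    rkhs_dot H (\sum_i c i *: f i) g = \sum_i c i * rkhs_dot H (f i) g by [].
elim/big_rec2: _ => [|i s h _ [Hh IH]].
  split=> //; have := rkhs_dot_linear 1 H0 H0 Hg.
  by rewrite scale1r addr0 mul1r => /esym/eqP; rewrite -subr_eq0 addrK => /eqP.
by rewrite rkhs_dot_linear// IH; split=> //; exact: Hlin.
Qed.

Lemma rkhs_kernel_function (R : realType) (k : {nonneg R} -> {nonneg R} -> R) :
  rkhs_kernel k -> kernel_function k.
Proof.
case=> H kH; have Hk y : rkhs_set H (k y) by have [] := kH y.
have kE x y : k x y = rkhs_dot H (k x) (k y) by have [_ ->] := kH y.
split=> [x y|n x _ c]; first by rewrite kE rkhs_dotC// -kE.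
have Hs : rkhs_set H (\sum_i c i 0 *: k (x i)) by exact: rkhs_set_sum.
rewrite (_ : _ 0 0 = rkhs_dot H (\sum_i c i 0 *: k (x i)) (\sum_i c i 0 *: k (x i))).
  exact: rkhs_dot_ge0.
rewrite rkhs_dot_suml// -mulmxA mxE; apply: eq_bigr => i _.
rewrite rkhs_dotC// rkhs_dot_suml// !mxE; congr (_ * _).
by apply: eq_bigr => j _; rewrite mxE mulrC rkhs_dotC// kE.
Qed.

Lemma consistent_space_finite_family (R : realType)
    (k : {nonneg R} -> {nonneg R} -> R) :
  (forall y, exists2 V, consistent_space V & V (k y)) ->
  forall (N : nat) (y : 'I_N -> {nonneg R}),
    exists2 V, consistent_space V & forall i, V (k (y i)).
Proof.
move=> kV; elim=> [|N IH] y.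
  exists (expmx_form_space (0 : 'M[R]_1) 0); first exact: expmx_form_space_consistent.
  by case.
have [V cV Vy] := IH (y \o lift ord0); have [W cW Wy] := kV (y ord0).
exists [set f | exists2 g, V g & exists2 h, W h & f = g + h].
  exact: consistent_space_add.
have [[[V0 _] _] _ _] := cV; have [[[W0 _] _] _ _] := cW.
move=> i; have [j ->|->] := unliftP ord0 i.
  by exists (k (y (lift ord0 j))); [exact: Vy|exists 0; rewrite ?addr0].
by exists 0 => //; exists (k (y ord0)); rewrite ?add0r.
Qed.

Lemma scalar_row (R : realType) (n : nat) (phi : {scalar 'cV[R]_n}) :
  exists r : 'rV[R]_n, forall v, phi v = (r *m v) 0 0.
Proof.
exists (\row_i phi (delta_mx i 0)) => v; rewrite {1}(matrix_sum_delta v) linear_sum mxE.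
by apply: eq_bigr => i _; rewrite big_ord1 linearZ mxE mulrC; congr (_ * _).
Qed.

Definition row_form (R : realType) (n : nat) (r : 'rV[R]_n) (v : 'cV[R]_n) : R :=
  (r *m v) 0 0.

Fact row_form_is_scalar (R : realType) (n : nat) (r : 'rV[R]_n) : scalar (row_form r).
Proof. by move=> a u v; rewrite /row_form mulmxDr -scalemxAr !mxE. Qed.

HB.instance Definition _ (R : realType) (n : nat) (r : 'rV[R]_n) :=
  GRing.isLinear.Build R 'cV[R]_n R *%R (row_form r) (row_form_is_scalar r).

Lemma U_set_consistent (R : realType) (f : {nonneg R} -> R) :
  U_set f -> exists2 V, consistent_space V & V f.
Proof.
case=> d [M [phi ->]]; have [r phiE] := scalar_row phi.
exists [set f | exists2 g, expmx_form_space 0 (e0 R d) g &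
                exists2 h, expmx_form_space M (e0 R d) h & f = g + h].
  by apply: consistent_space_add; exact: expmx_form_space_consistent.
exists (fun y => expmx_form 0 r (e0 R d) y%:num); first by exists r.
exists (fun y => expmx_form M (- r) (e0 R d) y%:num); first by exists (- r).
apply/funext => x; rewrite phiE !fctE /expmx_form scaler0 expmx0 mul1mx.
by rewrite mulmxBl mul1mx mulmxBr mulNmx [LHS]mxE.
Qed.

Lemma consistent_space_U_set (R : realType) (V : set ({nonneg R} -> R)) f :
  consistent_space V -> V f -> f (zero_Rplus R) = 0 -> U_set f.
Proof.
move=> [[_ [n [b [bV spanb]]]] VC1 dV] Vf f0.
have /choice[A AE] i : exists a : 'I_n -> R, deriv_Rplus (b i) = \sum_j a j *: b j.
  by apply: spanb; apply: dV; exists (b i).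
have [c cE] := spanb _ Vf.
pose B : 'M[R]_n := \matrix_(i, j) A i j.
pose bv x : 'cV[R]_n := \col_i b i x.
pose b0 := bv (zero_Rplus R).
pose M : 'M[R]_(1 + n) := block_mx 0 0 (B *m b0) B.
pose w x : 'cV[R]_(1 + n) := col_mx 1%:M (bv x - b0).
have Mw x : M *m w x = col_mx 0 (B *m bv x).
  by rewrite mul_block_col !mul0mx addr0 mulmx1 mulmxBr subrKC.
have w' (i : 'I_(1 + n)) x :
    diff_quotient (fun y => w y i 0) x @ increments x --> (M *m w x) i 0.
  rewrite Mw; case: (split_ordP i) => j ->.
    rewrite (_ : (fun y => w y _ 0) = fun=> 1); last first.
      by apply/funext => y; rewrite /w col_mxEu (ord1 j) mxE.
    rewrite col_mxEu mxE (_ : diff_quotient _ x = fun=> 0); last first.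
      by apply/funext => h; rewrite /diff_quotient /ext subrr mulr0.
    exact: cvg_cst.
  rewrite (_ : (fun y => w y _ 0) = fun y => b j y - b j (zero_Rplus R)); last first.
    by apply/funext => y; rewrite /w col_mxEd !mxE.
  rewrite (_ : diff_quotient _ x = diff_quotient (b j) x); last first.
    by apply/funext => h; rewrite /diff_quotient /ext opprB addrA subrK.
  rewrite col_mxEd (_ : (B *m bv x) j 0 = deriv_Rplus (b j) x).
    by apply: C1_diff_quotient; exact: VC1.
  by rewrite AE fct_sumE mxE; apply: eq_bigr => p _; rewrite !mxE.
have ode : @solves_ode R n M w := w'.
have w0 : w (zero_Rplus R) = e0 R n.
  rewrite /w subrr; apply/matrixP => i j; rewrite (ord1 j) {j}.
  case: (@split_ordP 1 n i) => p ->.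
    by rewrite (ord1 p) [LHS]col_mxEu !mxE.
  by rewrite [LHS]col_mxEd !mxE.
exists n, M, (row_form (row_mx 0 (- \row_i c i) : 'rV[R]_(1 + n))).
apply/funext => x; rewrite /= mulmxBl mul1mx -w0 -(solution_expmx x ode).
have -> : w (zero_Rplus R) - w x = col_mx 0 (b0 - bv x).
  by rewrite /w opp_col_mx add_col_mx subrr subrr sub0r opprB.
have row_col0 (r : 'rV[R]_n) u : row_mx 0 r *m col_mx (0 : 'cV_1) u = r *m u.
  by rewrite mul_row_col mul0mx add0r.
rewrite [RHS](congr1 (fun A : 'M[R]_1 => A 0 0) (row_col0 _ _)).
rewrite mulNmx -mulmxN opprB mulmxBr.
have fE y : f y = (\row_i c i *m bv y) 0 0.
  by rewrite cE fct_sumE mxE; apply: eq_bigr => i _; rewrite !mxE.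
by rewrite [RHS]mxE [X in _ = _ + X]mxE -!fE f0 subr0.
Qed.

Theorem proposition3p4 (R : realType) (k : {nonneg R} -> {nonneg R} -> R)
    (k_rkhs : rkhs_kernel k)
    (k_at0 : forall y : {nonneg R}, k y (zero_Rplus R) = 0) :
  fully_consistent k <-> forall y : {nonneg R}, U_set (k y).
Proof.
split=> [[_ kV] y|kU].
  have [V [fV VC1 dV Vk]] := kV 1 (fun=> y).
  by apply: (@consistent_space_U_set _ V) => //; exact: (Vk ord0).
split=> [|N y]; first exact: rkhs_kernel_function.
have [V [fV VC1 dV] Vk] :=
  consistent_space_finite_family (fun z => U_set_consistent (kU z)) y.
by exists V.
Qed.
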